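(* Let $B$ be an $n\times n$ nonsingular totally nonnegative matrix and let $1\le k\le n$. There are order-preserving maps (with respect to $\preceq$), intrinsic to $B$ (i.e. depending only on $B$ and $k$), $$\lambda_k(B),\ \rho_k(B):\binom{[n]}{k}\longrightarrow\binom{[n]}{k},\qquad \lambda_k(B)(I)\preceq I\preceq\rho_k(B)(I)\quad\text{for all } I\in\tbinom{[n]}{k},$$ such that for all $I,J\in\binom{[n]}{k}$ $$\Delta_{I,J}(B)>0\iff \lambda_k(B)(I)\preceq J\preceq\rho_k(B)(I).$$ The sets $\lambda_k(B)(I)$ and $\rho_k(B)(I)$ are the componentwise smallest and largest column indices $J$ of the positive entries in row $I$ of the multiplicative compound $C_k(B)$. If $A$ and $B$ are $n\times n$ nonsingular totally nonnegative matrices, then $$\lambda_k(AB)=\lambda_k(B)\circ\lambda_k(A),\qquad \rho_k(AB)=\rho_k(B)\circ\rho_k(A).$$ Consequently, for every $m\ge1$ and all $I,J\in\binom{[n]}{k}$, $$\Delta_{I,J}(B^m)>0\iff \lambda_k(B)^m(I)\preceq J\preceq\rho_k(B)^m(I),$$ where the exponent $m$ on a map denotes $m$-fold composition.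
   Context: All matrices are real and have order $n\ge2$. A matrix is totally nonnegative (TN) if all its minors are $\ge0$. Write $[n]=\{1,\dots,n\}$ and let $\binom{[n]}{k}$ be the set of $k$-subsets of $[n]$. For $I,J\in\binom{[n]}{k}$, $\Delta_{I,J}(A)=\det A[I,J]$ is the minor with row set $I$ and column set $J$ (taken in increasing order). The $k$-th multiplicative compound $C_k(A)$ is the matrix indexed by $\binom{[n]}{k}$ with $(I,J)$-entry $\Delta_{I,J}(A)$. For $I=\{i_1<\dots<i_k\}$ and $J=\{j_1<\dots<j_k\}$, write $I\preceq J$ if $i_r\le j_r$ for all $1\le r\le k$. A map $f$ on $\binom{[n]}{k}$ is order-preserving if $I\preceq J$ implies $f(I)\preceq f(J)$. *)

(* Defs.v *)
From mathcomp Require Import all_boot all_order all_algebra.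
From mathcomp Require Import reals.

Set Implicit Arguments.
Unset Strict Implicit.
Unset Printing Implicit Defensive.

Import Order.TTheory GRing.Theory Num.Theory.
Local Open Scope ring_scope.

Definition ksub (n k : nat) := {I : {set 'I_n} | #|I| == k}.

(* kth I r is the element i_(r+1) of I = {i_1 < ... < i_k}; [enum_val] follows
   the enumeration of 'I_n, which is increasing. *)
Definition kth (n k : nat) (I : ksub n k) (r : 'I_k) : 'I_n :=
  enum_val (cast_ord (esym (eqP (valP I))) r).

Definition minor (R : realType) (n k : nat) (A : 'M[R]_n) (I J : ksub n k) : R :=
  \det (mxsub (kth I) (kth J) A).

(* The index set of the compound stays ksub n k: going through 'I_('C(n, k))
   would need an arbitrary enumeration of the k-subsets. *)
Definition compound (R : realType) (n k : nat) (A : 'M[R]_n) :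
    ksub n k -> ksub n k -> R :=
  fun I J => minor A I J.

Definition totally_nonnegative (R : realType) (n : nat) (A : 'M[R]_n) : Prop :=
  forall (k : nat) (I J : ksub n k), 0 <= minor A I J.

Definition nonsingular_TN (R : realType) (n : nat) (A : 'M[R]_n) : Prop :=
  A \in unitmx /\ totally_nonnegative A.

Definition preceq (n k : nat) (I J : ksub n k) : bool :=
  [forall r : 'I_k, (kth I r <= kth J r)%N].

Definition order_preserving (n k : nat) (f : ksub n k -> ksub n k) : Prop :=
  {homo f : I J / preceq I J}.

Definition is_smallest (n k : nat) (P : ksub n k -> Prop) (L : ksub n k) : Prop :=
  P L /\ forall J, P J -> preceq L J.

Definition is_largest (n k : nat) (P : ksub n k -> Prop) (L : ksub n k) : Prop :=
  P L /\ forall J, P J -> preceq J L.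

(* Main.v *)
Require Import Defs.
From mathcomp Require Import all_boot all_order all_algebra.
From mathcomp Require Import reals.
From mathcomp Require Import perm zify ring.

Set Implicit Arguments.
Unset Strict Implicit.
Unset Printing Implicit Defensive.

Import Order.TTheory GRing.Theory Num.Theory.
Local Open Scope ring_scope.

(** A nonsingular totally nonnegative matrix is a product of positive diagonal
   matrices and of matrices [1 + c E_(p,q)] with [c > 0] and [p], [q] neighbours
   ([nonsingular_TN_ind]). Right multiplication by such a generator acts simply
   on positivity of minors: the new minor at [(I, J)] is positive exactly when
   the old minor at some [(I, K)] is, where [K = J] or [J] arises from [K] by
   moving the element [p] to the free neighbouring place [q] ([pos_mul_elem]).

   Two facts then propagate along the product ([nonsingular_TN_acts]). First,
   the positivity relation of [A *m B] is the composite of those of [A] and [B];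
   going through generators replaces the Cauchy-Binet formula by multilinearity
   in one column. Secondly, each positivity relation relates [I] exactly to the
   members of an interval that contains [I] and has endpoints monotone in [I].
   The interval property survives one generator because only the endpoint [U] in
   the direction of the move changes, and a [J] that lies below the new endpoint
   but not below [U] can be moved back by one place without leaving the old
   interval ([step_interval]). Taking for [lambda] and [rho] the endpoints, the
   composition laws follow from monotonicity.

   The factorization is Neville elimination. Its heart is Whitney's inequality
   ([whitney]): subtracting from row [p] the multiple of row [p - 1] that kills
   the lowest nonzero entry of the first column not yet reduced keeps all minors
   nonnegative. Minors having no row above [p] are settled by expanding one minor
   of the next order along that column. The rows above are added one at a time by
   the three-term relation ([three_term]), which needs no division by minors that
   might vanish: whenever the minor to be compared is nonzero, some minor in its
   row expansion is nonzero too, and the relation transfers the inequality from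
   that smaller minor. *)

(** * Strictly increasing index functions *)

Definition incr (n k : nat) (f : 'I_k -> 'I_n) : Prop :=
  forall i j : 'I_k, (i < j)%N -> (f i < f j)%N.

Definition upd (T : Type) (k : nat) (f : 'I_k -> T) (r : 'I_k) (x : T) :=
  fun s : 'I_k => if s == r then x else f s.

Definition adjacent (n : nat) (i j : 'I_n) : bool :=
  (j == i.+1 :> nat) || (i == j.+1 :> nat).

Lemma adjacent_sym (n : nat) (i j : 'I_n) : adjacent i j = adjacent j i.
Proof. by rewrite /adjacent orbC. Qed.

Lemma adjacent_neq (n : nat) (i j : 'I_n) : adjacent i j -> i != j.
Proof. by rewrite /adjacent -val_eqE /=; lia. Qed.

Lemma incr_ltn (n k : nat) (f : 'I_k -> 'I_n) (i j : 'I_k) :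
  incr f -> (f i < f j)%N = (i < j)%N.
Proof.
move=> fI; case: (ltngtP i j) => [/fI //|/fI|/val_inj->]; first lia.
by rewrite ltnn.
Qed.

Lemma incr_inj (n k : nat) (f : 'I_k -> 'I_n) : incr f -> injective f.
Proof.
move=> fI i j e; have := incr_ltn i j fI; have := incr_ltn j i fI.
by rewrite e ltnn => h1 h2; apply: val_inj => /=; lia.
Qed.

Lemma incr_comp (n k l : nat) (f : 'I_k -> 'I_n) (h : 'I_l -> 'I_k) :
  incr f -> incr h -> incr (f \o h).
Proof. by move=> fI hI i j /hI/fI. Qed.

Lemma incr_lift (k : nat) (r : 'I_k) : incr (lift r).
Proof. by move=> i j ij; rewrite /= /bump; lia. Qed.

Lemma incr_upd_between (n k : nat) (f : 'I_k -> 'I_n) (r : 'I_k) (x : 'I_n) :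
  incr f -> (forall s : 'I_k, (s < r)%N -> (f s < x)%N) ->
  (forall s : 'I_k, (r < s)%N -> (x < f s)%N) -> incr (upd f r x).
Proof.
move=> fI lo hi i j ij; rewrite /upd.
case: (eqVneq i r) => [ir|ni]; case: (eqVneq j r) => [jr|nj].
- by subst; lia.
- by subst; exact: hi.
- by subst; exact: lo.
- exact: fI.
Qed.

(** Moving one value to a free neighbour cannot jump over another value. *)
Lemma incr_upd (n k : nat) (f : 'I_k -> 'I_n) (r : 'I_k) (x : 'I_n) :
  incr f -> adjacent (f r) x -> (forall s, f s != x) -> incr (upd f r x).
Proof.
move=> fI + fx; rewrite /adjacent => frx.
apply: incr_upd_between => // s sr; have := fI _ _ sr; have := fx s;
  by rewrite -val_eqE /=; lia.
Qed.

(** Increasing index functions are the same thing as k-subsets: they are easier to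
   modify at one place, which is what every row and column operation does. *)
Lemma kth_incr (n k : nat) (I : ksub n k) : incr (kth I).
Proof.
move=> i j ij; rewrite /kth /enum_val.
set a := cast_ord _ i; set b := cast_ord _ j.
have s : sorted ltn [seq val x | x <- enum (val I)].
  rewrite /enum_mem -enumT sorted_map.
  apply: sorted_filter; first by move=> y x z; exact: ltn_trans.
  by rewrite -sorted_map val_enum_ord iota_ltn_sorted.
have := sorted_ltn_nth ltn_trans 0%N s.
move=> /(_ a b); rewrite !inE size_map -cardE => /(_ (ltn_ord a) (ltn_ord b) ij).
rewrite !(nth_map (enum_default a)) -?cardE ?ltn_ord // => h.
by rewrite (set_nth_default (enum_default a) (enum_default b)) // -cardE.
Qed.

Lemma mem_kth (n k : nat) (I : ksub n k) (x : 'I_n) :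
  x \in val I -> exists r, kth I r = x.
Proof.
move=> xI; exists (cast_ord (eqP (valP I)) (enum_rank_in xI x)).
by rewrite /kth cast_ordK enum_rankK_in.
Qed.

Lemma kth_mem (n k : nat) (I : ksub n k) r : kth I r \in val I.
Proof. exact: enum_valP. Qed.

Lemma kth_inj (n k : nat) (I J : ksub n k) : kth I =1 kth J -> I = J.
Proof.
move=> e; apply/val_inj/setP => x; apply/idP/idP => /mem_kth[r <-].
  by rewrite e kth_mem.
by rewrite -e kth_mem.
Qed.

Lemma incr_kth (n k : nat) (f : 'I_k -> 'I_n) :
  incr f -> exists I : ksub n k, kth I =1 f.
Proof.
move=> fI; pose S := f @: [set: 'I_k].
have cS : #|S| == k by rewrite card_imset ?cardsT ?card_ord //; exact: incr_inj.
exists (exist _ S cS : ksub n k); set I := exist _ _ _.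
have e : [seq kth I i | i <- enum 'I_k] = [seq f i | i <- enum 'I_k].
  have srt (h : 'I_k -> 'I_n) :
    incr h -> sorted (fun x y : 'I_n => x < y)%N [seq h i | i <- enum 'I_k].
    move=> hI; rewrite sorted_map.
    have: sorted ltn [seq val x | x <- enum 'I_k].
      by rewrite val_enum_ord iota_ltn_sorted.
    by rewrite sorted_map; apply: sub_sorted => x y; exact: hI.
  apply: (@irr_sorted_eq _ (fun x y : 'I_n => x < y)%N).
  - by move=> y x z; exact: ltn_trans.
  - by move=> x /=; rewrite ltnn.
  - by apply: srt; exact: kth_incr.
  - exact: srt.
  move=> x; apply/mapP/mapP => -[r _ ->].
    have /imsetP[s _ ->] : kth I r \in S by exact: kth_mem.
    by exists s => //; rewrite mem_enum.
  have /mem_kth[s <-] : f r \in val I by rewrite imset_f.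
  by exists s => //; rewrite mem_enum.
by move=> r; move/eq_in_map: e; apply; rewrite mem_enum.
Qed.

Lemma preceqP (n k : nat) (I J : ksub n k) :
  reflect (forall r, (kth I r <= kth J r)%N) (preceq I J).
Proof. exact: forallP. Qed.

Lemma preceq_refl (n k : nat) (I : ksub n k) : preceq I I.
Proof. by apply/preceqP. Qed.

Lemma preceq_trans (n k : nat) (J I K : ksub n k) :
  preceq I J -> preceq J K -> preceq I K.
Proof. by move=> /preceqP h /preceqP h'; apply/preceqP => r; apply: leq_trans (h' r). Qed.

Lemma preceq_anti (n k : nat) (I J : ksub n k) :
  preceq I J -> preceq J I -> I = J.
Proof.
move=> /preceqP h /preceqP h'; apply: kth_inj => r; apply: val_inj => /=.
by apply/eqP; rewrite eqn_leq h h'.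
Qed.

(** * A three-term determinantal identity *)

Definition rset (R : Type) (m n : nat) (X : 'M[R]_(m, n)) (r : 'I_m) (u : 'rV[R]_n) :=
  \matrix_(i, j) if i == r then u ord0 j else X i j.

Section ThreeTerm.
Variables (R : comPzRingType) (m : nat).
Implicit Types (X : 'M[R]_m) (a r j : 'I_m) (u w z : 'rV[R]_m).

Lemma det_rset X r u : \det (rset X r u) = \sum_l u ord0 l * cofactor X r l.
Proof.
rewrite (expand_det_row _ r); apply: eq_bigr => l _; rewrite mxE eqxx.
congr (_ * (_ * \det _)); apply/matrixP => i k; rewrite !mxE.
by rewrite eq_sym (negPf (neq_lift _ _)).
Qed.

Lemma det_rset_delta X r j : \det (rset X r (delta_mx ord0 j)) = cofactor X r j.
Proof.
rewrite det_rset (bigD1 j) //= !mxE !eqxx mul1r big1 ?addr0 // => l lj.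
by rewrite !mxE (negPf lj) mul0r.
Qed.

Lemma rset_comm X a r u w :
  a != r -> rset (rset X a u) r w = rset (rset X r w) a u.
Proof.
move=> ar; apply/matrixP => i l; rewrite !mxE.
by case: (eqVneq i r) => // ->; rewrite eq_sym (negPf ar).
Qed.

Lemma det_rset_swap X a r u w : a != r ->
  \det (rset (rset X a u) r w) = - \det (rset (rset X a w) r u).
Proof.
move=> ar; transitivity (\det (xrow a r (rset (rset X a w) r u))).
  congr (\det _); apply/matrixP => i l; rewrite !mxE.
  case: tpermP => [->|->|/eqP/negPf ia /eqP/negPf ir].
  - by rewrite !eqxx (negPf ar).
  - by rewrite !eqxx (negPf ar).
  by rewrite ir ia.
by rewrite xrowE det_mulmx det_perm odd_tperm ar mulN1r.
Qed.

(** The left side is linear in [z], and [\det X *: z] is the combination of the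
   rows of [X] whose coefficients are the determinants of [X] with one row
   replaced by [z] (Cramer); only the rows [a] and [r] contribute. This is the
   three-term Pluecker relation with its signs hidden in the cofactors. *)
Lemma three_term X a r j z : a != r ->
  \det X * cofactor (rset X r z) a j =
  \det (rset X r z) * cofactor X a j - \det (rset X a z) * cofactor X r j.
Proof.
move=> ar; set W := rset X a (delta_mx ord0 j).
pose c := \col_l cofactor W r l.
(* [c] does not depend on [u]: row [r] is discarded by its own cofactors. *)
have phi u : cofactor (rset X r u) a j = (u *m c) ord0 ord0.
  rewrite -det_rset_delta rset_comm 1?eq_sym // det_rset mxE.
  by apply: eq_bigr => l _; rewrite mxE.
pose v := z *m \adj X.
have vE i : v ord0 i = \det (rset X i z).
  by rewrite det_rset mxE; apply: eq_bigr => l _; rewrite mxE.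
have zE : \det X *: z = \sum_i v ord0 i *: row i X.
  by rewrite -mulmx_sum_row -mulmxA mul_adj_mx mul_mx_scalar.
have -> : \det X * cofactor (rset X r z) a j = ((\det X *: z) *m c) ord0 ord0.
  by rewrite phi -scalemxAl [RHS]mxE.
rewrite zE mulmx_suml summxE (bigD1 r) //= (bigD1 a) //= big1 => [|i /andP[ir ia]].
  have phiZ (x : R) i : (x *: row i X *m c) ord0 ord0 =
      x * cofactor (rset X r (row i X)) a j by rewrite phi -scalemxAl [LHS]mxE.
  rewrite addr0 !phiZ.
  rewrite !vE -!det_rset_delta.
  have -> : rset X r (row r X) = X.
    by apply/matrixP => i l; rewrite !mxE; case: eqP => // ->.
  rewrite rset_comm 1?eq_sym // det_rset_swap // mulrN.
  congr (_ - _ * \det _); apply/matrixP => i l; rewrite !mxE.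
  by case: (eqVneq i r) => // _; case: eqP => // ->.
rewrite -scalemxAl mxE -phi -det_rset_delta.
rewrite (@determinant_alternate _ _ _ i r) ?mulr0 // => l.
by rewrite !mxE (negPf ia) (negPf ir) [r == a]eq_sym (negPf ar) eqxx.
Qed.
End ThreeTerm.

(** * Whitney's inequality *)

Section TN.
Variables (R : realType) (n : nat).
Implicit Types (A B : 'M[R]_n).

Lemma TN_det_ge0 A : totally_nonnegative A ->
  forall k (f g : 'I_k -> 'I_n), incr f -> incr g -> 0 <= \det (mxsub f g A).
Proof.
move=> tA k f g /incr_kth[I fI] /incr_kth[J gJ].
by rewrite -(eq_mxsub _ _ fI gJ); exact: tA.
Qed.

Lemma TN_entry_ge0 A i j : totally_nonnegative A -> 0 <= A i j.
Proof.
move=> tA; have h x : incr (fun _ : 'I_1 => x : 'I_n).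
  by move=> a b; rewrite !ord1.
by have := TN_det_ge0 tA (h i) (h j); rewrite det_mx11 mxE.
Qed.

Lemma TN_minor2_ge0 A (i i' j j' : 'I_n) : totally_nonnegative A ->
  (i < i')%N -> (j < j')%N -> A i j' * A i' j <= A i j * A i' j'.
Proof.
move=> tA ii' jj'.
have h (x y : 'I_n) : (x < y)%N -> incr (fun a : 'I_2 => if a == ord0 then x else y).
  by move=> xy [[|[|?]] ?] [[|[|?]] ?].
have := TN_det_ge0 tA (h _ _ ii') (h _ _ jj').
rewrite (expand_det_row _ ord0) !big_ord_recl big_ord0 /cofactor !det_mx11 !mxE /=.
by rewrite addr0 expr0 expr1 mul1r mulN1r mulrN subr_ge0.
Qed.

Definition consf (k : nat) (x : 'I_n) (f : 'I_k -> 'I_n) (i : 'I_k.+1) : 'I_n :=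
  if unlift ord0 i is Some i' then f i' else x.

Lemma incr_consf (k : nat) (x : 'I_n) (f : 'I_k -> 'I_n) :
  (forall i, (x < f i)%N) -> incr f -> incr (consf x f).
Proof.
move=> xf fI i j ij; rewrite /consf.
case: unliftP ij => [j'|] -> //; case: unliftP => [i'|] -> //= ij.
by apply: fI; move: ij; rewrite /bump; lia.
Qed.

(** The setting of one elimination step at the entry [(p, j)]: the columns before
   [j] already vanish from row [q] on, and [p] is the last row that may be nonzero
   in column [j]. *)
Section Whitney.
Variables (B : 'M[R]_n) (p q j : 'I_n).
Hypotheses (tB : totally_nonnegative B) (pq : p = q.+1 :> nat).
Hypothesis left0 : forall i l : 'I_n, (q <= i)%N -> (l < j)%N -> B i l = 0.
Hypothesis below0 : forall i : 'I_n, (p < i)%N -> B i j = 0.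

(** With no row above [p], expanding along column [j] the minor whose rows are
   [q, p, ...] and whose columns are [j] followed by [g] leaves just two terms,
   and their difference is the claim; if [g] starts at or before [j], the first
   column of both minors is supported on the first row. *)
Let whitney_base (k : nat) (f g : 'I_k.+1 -> 'I_n) :
  incr f -> incr g -> f ord0 = p ->
  B p j * \det (mxsub (upd f ord0 q) g B) <= B q j * \det (mxsub f g B).
Proof.
move=> fI gI f0; have fS i : (p < f (lift ord0 i))%N by rewrite -f0 incr_ltn.
have det1 h : h \o lift ord0 =1 f \o lift ord0 -> g ord0 = j ->
    \det (mxsub h g B) =
    B (h ord0) j * \det (mxsub (f \o lift ord0) (g \o lift ord0) B).
  move=> hf g0; rewrite (expand_det_col _ ord0) big_ord_recl big1 => [|i _].
    rewrite mxE g0 addr0 /cofactor expr0 mul1r.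
    rewrite -(eq_mxsub _ _ hf (fun=> erefl)); congr (_ * \det _).
    by apply/matrixP => i l; rewrite !mxE.
  by have /= hfi := hf i; rewrite mxE g0 hfi below0 ?mul0r.
have det0 (h : 'I_k.+1 -> 'I_n) : (forall i, (q <= h i)%N) -> (g ord0 < j)%N -> \det (mxsub h g B) = 0.
  move=> hq g0; rewrite (expand_det_col _ ord0) big1 // => i _.
  by rewrite mxE left0 ?mul0r.
have updS : upd f ord0 q \o lift ord0 =1 f \o lift ord0 by move=> i; rewrite /upd.
case: (ltngtP (g ord0) j) => [g0|g0|/val_inj g0].
- rewrite !det0 ?mulr0 // => i; rewrite ?/upd; case: (unliftP ord0 i) => [i'|] -> //=.
  + by have := fS i'; lia.
  + by rewrite f0; lia.
  + by have := fS i'; lia.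
- have FI : incr (consf q f).
    apply: incr_consf => // i; case: (unliftP ord0 i) => [i'|] ->; last by rewrite f0; lia.
    by have := fS i'; lia.
  have GI : incr (consf j g).
    apply: incr_consf => // i; case: (unliftP ord0 i) => [i'|] -> //.
    by apply: ltn_trans g0 _; rewrite incr_ltn.
  have := TN_det_ge0 tB FI GI.
  rewrite (expand_det_col _ ord0) !big_ord_recl big1 => [|i _].
    rewrite /cofactor !mxE /consf !unlift_none !liftK f0 addr0 /= expr0 mul1r.
    rewrite mulN1r mulrN subr_ge0 => h.
    have -> : mxsub f g B = row' ord0 (col' ord0 (mxsub (consf q f) (consf j g) B)).
      by apply/matrixP => a b; rewrite !mxE /consf !liftK.
    have -> : mxsub (upd f ord0 q) g B =
      row' (lift ord0 ord0) (col' ord0 (mxsub (consf q f) (consf j g) B)).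
      apply/matrixP => a b; rewrite !mxE /consf !liftK /upd.
      case: (unliftP ord0 a) => [a'|] ->.
        have -> : lift (lift ord0 ord0) (lift ord0 a') = lift ord0 (lift ord0 a').
          by apply: val_inj.
        by rewrite liftK.
      have -> : lift (lift ord0 ord0) ord0 = ord0 :> 'I_k.+2 by apply: val_inj.
      by rewrite unlift_none.
    exact: h.
  by rewrite mxE /consf unlift_none liftK below0 ?mul0r.
- by rewrite !det1 // /upd eqxx f0 mulrCA.
Qed.

(** Induction on the order of the minor. Let [a] be the position just before [r].
   The three-term relation for [X], the minor with row [q] in place of [p], reads
   [\det X * Mp = Df * Mq - Dh * Ms] where all quantities are nonnegative minors
   and [Mp], [Mq] are one order smaller, lack the row at [a], and satisfy the
   inequality by induction. If [\det X] is not zero, the column deleted can be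
   chosen with [Mq] positive. *)
Lemma whitney (k : nat) (f g : 'I_k -> 'I_n) (r : 'I_k) :
  incr f -> incr g -> f r = p -> (forall i, f i != q) ->
  B p j * \det (mxsub (upd f r q) g B) <= B q j * \det (mxsub f g B).
Proof.
elim: k f g r => [|k IH] f g r fI gI fr fq; first by case: r fr.
case: (unliftP ord0 r) => [r'|] rE; last by rewrite rE in fr *; exact: whitney_base.
have ka : (r.-1 < k.+1)%N by have := ltn_ord r; lia.
have rS : r = r'.+1 :> nat by rewrite rE.
set a : 'I_k.+1 := Ordinal ka.
have ra : r = a.+1 :> nat by rewrite /= rS.
have nar : a != r by rewrite -val_eqE /=; lia.
have lo (s : 'I_k.+1) : (s < r)%N -> (f s < q)%N.
  move=> sr; have := fI _ _ sr; have := fq s.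
  by rewrite -val_eqE fr /=; lia.
have hi (s : 'I_k.+1) : (r < s)%N -> (q < f s)%N.
  by move=> sr; have := fI _ _ sr; rewrite fr; lia.
have f'I : incr (upd f r q) by exact: incr_upd_between.
have hI : incr (upd f a q).
  apply: incr_upd_between => // s sa; first by apply: lo; lia.
  case: (eqVneq s r) => [->|sr]; first by rewrite fr; lia.
  by apply: hi; move: sr; rewrite -val_eqE /=; lia.
set X := mxsub (upd f r q) g B.
pose z := \row_l B p (g l).
have Xf : rset X r z = mxsub f g B.
  by apply/matrixP => i l; rewrite !mxE /upd; case: eqP => // ->; rewrite fr.
(* The rows [p], [q] of [rset X a z] come in the wrong order, whence the sign. *)
have Xh : \det (rset X a z) = - \det (mxsub (upd f a q) g B).
  have -> : rset X a z = rset (rset X a z) r (row r X).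
    apply/matrixP => i l; rewrite !mxE /upd eqxx.
    by case: (eqVneq i r) => // ->; rewrite eq_sym (negPf nar).
  rewrite det_rset_swap //; congr (- \det _); apply/matrixP => i l.
  rewrite !mxE /upd eqxx; case: (eqVneq i r) => [->|].
    by rewrite eq_sym (negPf nar) fr.
  by case: (eqVneq i a).
have D0 : 0 <= \det X by exact: TN_det_ge0.
have Df0 : 0 <= \det (mxsub f g B) by exact: TN_det_ge0.
have Dh0 : 0 <= \det (mxsub (upd f a q) g B) by exact: TN_det_ge0.
have [DX0|DXn] := eqVneq (\det X) 0.
  by rewrite DX0 mulr0 mulr_ge0 // TN_entry_ge0.
have [l Ml] : exists l, cofactor X a l != 0.
  apply/existsP; apply: contraNT DXn; rewrite negb_exists => /forallP h.
  rewrite (expand_det_row _ a) big1 // => l _.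
  by have := h l; rewrite negbK => /eqP->; rewrite mulr0.
have cofE h i : cofactor (mxsub h g B) i l =
    (-1) ^+ (i + l) * \det (mxsub (h \o lift i) (g \o lift l) B).
  by congr (_ * \det _); apply/matrixP => b c; rewrite !mxE.
have := three_term X l z nar; rewrite Xf Xh {4}/X.
(* As [r] follows [a], the cofactors at [a] and at [r] have opposite signs. *)
move: Ml; rewrite !cofE ra addSn exprS mulf_eq0 signr_eq0 /=.
set s := _ ^+ _.
have gI' : incr (g \o lift l) by apply: incr_comp => //; exact: incr_lift.
set Mq := \det (mxsub (upd f r q \o lift a) _ _).
set Ms := \det (mxsub (upd f r q \o lift r) _ _).
set Mp := \det (mxsub (f \o lift a) _ _).
set D := \det X; set Df := \det (mxsub f g B); set Dh := \det (mxsub (upd f a q) g B).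
have Mq0 : 0 <= Mq.
  by apply: TN_det_ge0 => //; apply: incr_comp => //; exact: incr_lift.
have Ms0 : 0 <= Ms.
  by apply: TN_det_ge0 => //; apply: incr_comp => //; exact: incr_lift.
move=> Mqn E; have {Mqn Mq0} Mq0 : 0 < Mq by rewrite lt_neqAle eq_sym Mqn.
have {}E : D * Mp = Df * Mq - Dh * Ms.
  have sn : s != 0 by rewrite signr_eq0.
  by apply: (mulfI sn); rewrite mulrCA E; ring.
have [r1 r1E] : exists r1, r = lift a r1.
  case: (unliftP a r) => [r1 ->|ar]; first by exists r1.
  by rewrite ar eqxx in nar.
have /(_ (f \o lift a) (g \o lift l) r1) := IH.
have -> : mxsub (upd (f \o lift a) r1 q) (g \o lift l) B =
    mxsub (upd f r q \o lift a) (g \o lift l) B.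
  apply: eq_mxsub => // i; rewrite /upd /= r1E.
  by rewrite (inj_eq lift_inj).
rewrite -/Mq -/Mp /= -r1E => /(_ _ gI' fr (fun i => fq _)) H.
have {}H : B p j * Mq <= B q j * Mp.
  by apply: H; apply: incr_comp => //; exact: incr_lift.
rewrite -(ler_pM2r Mq0).
have -> : B q j * Df * Mq = D * (B q j * Mp) + B q j * (Dh * Ms).
  by rewrite mulrCA E; ring.
have -> : B p j * D * Mq = D * (B p j * Mq) by ring.
apply: le_trans (ler_wpM2l D0 H) _.
by rewrite lerDl !mulr_ge0 // TN_entry_ge0.
Qed.
End Whitney.
End TN.

(** * Factorization into elementary bidiagonal and diagonal matrices *)

Definition elem (R : realType) (n : nat) (c : R) (p q : 'I_n) : 'M[R]_n :=
  1%:M + c *: delta_mx p q.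

Section Factorization.
Variables (R : realType) (n : nat).
Implicit Types (A B : 'M[R]_n) (c : R) (p q : 'I_n).

Lemma elem_mulE c p q A i j :
  (elem c p q *m A) i j = A i j + (if i == p then c * A q j else 0).
Proof.
rewrite /elem mulmxDl mul1mx !mxE; congr (_ + _).
rewrite (bigD1 q) //= !mxE eqxx andbT big1 => [|l lq]; last first.
  by rewrite !mxE (negPf lq) andbF mulr0 mul0r.
by case: eqP; rewrite addr0 ?mulr1 // mulr0 mul0r.
Qed.

Lemma elem_tr c p q : (elem c p q)^T = elem c q p.
Proof. by rewrite /elem raddfD /= trmx1 linearZ /= trmx_delta. Qed.

Lemma mul_elemN c p q : p != q -> elem c p q *m elem (- c) p q = 1%:M.
Proof.
move=> pq; apply/matrixP => i j; rewrite elem_mulE /elem !mxE.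
have [->|ip] := eqVneq i p; last by rewrite /= mulr0 !addr0.
rewrite /= [q == p]eq_sym (negPf pq) /= mulr0 addr0.
by rewrite [j == q]eq_sym; case: (q == j) => /=; ring.
Qed.

Lemma elem_unit c p q : p != q -> elem c p q \in unitmx.
Proof. by move=> pq; have [] := mulmx1_unit (mul_elemN c pq). Qed.

Lemma det_elem_mul c p q A k (f g : 'I_k -> 'I_n) r : injective f -> f r = p ->
  \det (mxsub f g (elem c p q *m A)) =
  \det (mxsub f g A) + c * \det (mxsub (upd f r q) g A).
Proof.
move=> fI fr; rewrite -[X in X + _]mul1r.
apply: (determinant_multilinear (i0 := r)).
- by apply/rowP => l; rewrite mxE [LHS]mxE elem_mulE !mxE fr /upd !eqxx mul1r.
- apply/matrixP => i l; rewrite mxE [RHS]mxE [LHS]mxE [RHS]mxE elem_mulE.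
  by rewrite -fr (inj_eq fI) eq_sym (negPf (neq_lift _ _)) addr0.
- apply/matrixP => i l; rewrite mxE [RHS]mxE [LHS]mxE [RHS]mxE elem_mulE /upd.
  by rewrite -fr (inj_eq fI) eq_sym (negPf (neq_lift _ _)) addr0.
Qed.

Lemma det_elem_mul_id c p q A k (f g : 'I_k -> 'I_n) : (forall i, f i != p) ->
  \det (mxsub f g (elem c p q *m A)) = \det (mxsub f g A).
Proof.
move=> fp; congr (\det _); apply/matrixP => i l.
by rewrite mxE [RHS]mxE elem_mulE (negPf (fp i)) addr0.
Qed.

Lemma det_upd_repeat A k (f g : 'I_k -> 'I_n) r s : s != r ->
  \det (mxsub (upd f r (f s)) g A) = 0.
Proof.
move=> sr; rewrite (@determinant_alternate _ _ _ s r) // => l.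
by rewrite !mxE /upd eqxx (negPf sr).
Qed.

Lemma TN_intro A :
  (forall k (f g : 'I_k -> 'I_n), incr f -> incr g -> 0 <= \det (mxsub f g A)) ->
  totally_nonnegative A.
Proof. by move=> h k I J; apply: h; exact: kth_incr. Qed.

Lemma TN_tr A : totally_nonnegative A -> totally_nonnegative A^T.
Proof.
move=> tA; apply: TN_intro => k f g fI gI.
by rewrite -trmx_mxsub det_tr; exact: TN_det_ge0.
Qed.

Lemma nonsingular_TN_tr A : nonsingular_TN A -> nonsingular_TN A^T.
Proof. by case=> uA tA; split; [rewrite unitmx_tr | exact: TN_tr]. Qed.

(** Only a minor that uses row [p] but not row [q] changes, and there Whitney's
   inequality says that the new value is nonnegative. *)
Lemma TN_neville_step B p q (j : 'I_n) : totally_nonnegative B -> p = q.+1 :> nat ->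
  (forall i l : 'I_n, (q <= i)%N -> (l < j)%N -> B i l = 0) ->
  (forall i : 'I_n, (p < i)%N -> B i j = 0) -> 0 < B q j ->
  totally_nonnegative (elem (- (B p j / B q j)) p q *m B).
Proof.
move=> tB pq left0 below0 Bqj; apply: TN_intro => k f g fI gI.
case: (pickP (fun i => f i == p)) => [r /eqP fr|fp]; last first.
  by rewrite det_elem_mul_id => [|i]; [exact: TN_det_ge0 | rewrite fp].
rewrite (det_elem_mul _ _ _ _ (incr_inj fI) fr).
case: (pickP (fun i => f i == q)) => [s /eqP fs|fq].
  rewrite -fs det_upd_repeat ?mulr0 ?addr0; first exact: TN_det_ge0.
  by apply/eqP => sr; move: pq; rewrite -fr -fs sr; lia.
have := whitney tB pq left0 below0 fI gI fr (fun i => negbT (fq i)).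
by rewrite mulNr subr_ge0 mulrAC ler_pdivrMr // [_ * B q j]mulrC.
Qed.

(** The number of nonzero entries is the termination measure of the elimination:
   entries that vanish stay zero, since a nonnegative quantity is subtracted from
   them and the result is again nonnegative. *)
Definition nnz B := #|[set ij : 'I_n * 'I_n | B ij.1 ij.2 != 0]|.

Lemma nnz_tr B : nnz B^T = nnz B.
Proof.
pose sw (ij : 'I_n * 'I_n) := (ij.2, ij.1).
have swK : cancel sw sw by case.
rewrite /nnz -[RHS](card_imset _ (can_inj swK)).
apply: eq_card => -[i j]; rewrite inE /=.
rewrite mxE; apply/idP/imsetP => [h|[[a b]]].
  by exists (j, i); rewrite // inE.
by rewrite inE /= => h [-> ->].
Qed.

Lemma row_nonzero B i : B \in unitmx -> exists j, B i j != 0.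
Proof.
move=> uB; apply/existsP; apply: contraTT uB; rewrite negb_exists => /forallP h.
rewrite unitmxE (expand_det_row _ i) big1 ?unitr0 // => j _.
by have := h j; rewrite negbK => /eqP->; rewrite mul0r.
Qed.

(** The pivot [q], the row above the lowest nonzero entry [p] of the first column
   that is nonzero below the diagonal, is positive: otherwise the minors of order
   two on rows [q], [p] would force the whole row [q] to vanish. *)
Lemma neville_reduce B (i0 j0 : 'I_n) : nonsingular_TN B -> (j0 < i0)%N -> B i0 j0 != 0 ->
  exists c p q B', [/\ 0 < c, adjacent p q, B = elem c p q *m B',
    nonsingular_TN B' & (nnz B' < nnz B)%N].
Proof.
move=> [uB tB] ij0 Bij0.
have [j /existsP[i1 /andP[ji1 Bi1]] jmin] :
    exists2 j : 'I_n, [exists i : 'I_n, (j < i)%N && (B i j != 0)] &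
    forall l : 'I_n, [exists i : 'I_n, (l < i)%N && (B i l != 0)] -> (j <= l)%N.
  have h : [exists i : 'I_n, (j0 < i)%N && (B i j0 != 0)].
    by apply/existsP; exists i0; rewrite ij0.
  by case: (@arg_minnP _ j0 (fun l => [exists i : 'I_n, (l < i)%N && (B i l != 0)]) val h) => j hj hm; exists j.
have [p /andP[jp Bpj] pmax] :
    exists2 p : 'I_n, (j < p)%N && (B p j != 0) &
    forall i : 'I_n, (j < i)%N && (B i j != 0) -> (i <= p)%N.
  have h : (j < i1)%N && (B i1 j != 0) by rewrite ji1.
  by case: (@arg_maxnP _ i1 (fun i => (j < i)%N && (B i j != 0)) val h) => p hp hm; exists p.
have qn : (p.-1 < n)%N by have := ltn_ord p; lia.
pose q := Ordinal qn; have pq : p = q.+1 :> nat by rewrite /=; lia.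
clearbody q.
have low0 (i l : 'I_n) : (l < i)%N -> (l < j)%N -> B i l = 0.
  move=> li lj; apply/eqP; apply: contraTT lj => nz; rewrite -leqNgt.
  by apply: jmin; apply/existsP; exists i; rewrite li.
have left0 (i l : 'I_n) : (q <= i)%N -> (l < j)%N -> B i l = 0.
  by move=> qi lj; apply: low0 => //; lia.
have below0 (i : 'I_n) : (p < i)%N -> B i j = 0.
  move=> pi; apply/eqP/negPn/negP => nz.
  by have := pmax i; rewrite nz andbT; lia.
have Bp : 0 < B p j by rewrite lt_neqAle eq_sym Bpj TN_entry_ge0.
have Bq : 0 < B q j.
  rewrite lt_neqAle eq_sym TN_entry_ge0 // andbT; apply/eqP => Bq0.
  have [l] := row_nonzero q uB; case: (ltngtP l j) => [lj|jl|/val_inj->].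
  - by rewrite left0 ?eqxx.
  - have qp : (q < p)%N by rewrite pq.
    have := TN_minor2_ge0 tB qp jl; rewrite Bq0 mul0r pmulr_lle0 // => h.
    by rewrite eq_le h TN_entry_ge0.
  - by rewrite Bq0 eqxx.
have npq : p != q by rewrite -val_eqE /= pq; lia.
set c := B p j / B q j; have c0 : 0 < c by rewrite divr_gt0.
have tB' := TN_neville_step tB pq left0 below0 Bq; rewrite -/c in tB'.
set B' := _ *m B in tB'.
have BE : B = elem c p q *m B' by rewrite /B' mulmxA mul_elemN // mul1mx.
exists c, p, q, B'; split => //.
- by rewrite /adjacent pq eqxx orbT.
- by split=> //; move: uB; rewrite BE unitmx_mul => /andP[].
apply: proper_card; apply/properP; split.
  apply/subsetP => -[i l]; rewrite !inE /=; apply: contraNN => /eqP B0.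
  have := TN_entry_ge0 i l tB'; rewrite /B' elem_mulE B0.
  case: eqP => _; last by rewrite addr0.
  rewrite add0r mulNr oppr_ge0 => h; rewrite oppr_eq0 eq_le h.
  by rewrite mulr_ge0 ?TN_entry_ge0 // ltW.
exists (p, j); rewrite !inE //= negbK /B' elem_mulE eqxx /c.
by rewrite mulNr divfK ?subrr // gt_eqF.
Qed.

(** The bidiagonal factorization as an induction principle. Entries below the
   diagonal are eliminated by rows; those above it by eliminating in the
   transpose; what remains is diagonal, with positive entries as no row is zero. *)
Lemma nonsingular_TN_ind (P : 'M[R]_n -> Prop) :
  (forall d : 'rV[R]_n, (forall i, 0 < d ord0 i) -> P (diag_mx d)) ->
  (forall c p q, 0 < c -> adjacent p q -> P (elem c p q)) ->
  (forall A B, P A -> P B -> P (A *m B)) ->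
  forall B, nonsingular_TN B -> P B.
Proof.
move=> Pd Pe Pm B; have [N] := ubnP (nnz B); elim: N B => // N IH B /ltnSE BN nB.
have [lB|] := boolP [exists i : 'I_n, exists j : 'I_n, (j < i)%N && (B i j != 0)].
  have /existsP[i /existsP[j /andP[ji Bij]]] := lB.
  have [c [p [q [B' [c0 pq BE nB' lt]]]]] := neville_reduce nB ji Bij.
  by rewrite BE; apply: Pm; [exact: Pe | apply: IH => //; lia].
rewrite negb_exists => /forallP noL.
have [uB|] := boolP [exists i : 'I_n, exists j : 'I_n, (j < i)%N && (B^T i j != 0)].
  have /existsP[i /existsP[j /andP[ji Bij]]] := uB.
  have [c [p [q [B' [c0 pq BE nB' lt]]]]] :=
    neville_reduce (nonsingular_TN_tr nB) ji Bij.
  rewrite -[B]trmxK BE trmx_mul elem_tr; apply: Pm.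
    apply: IH; last exact: nonsingular_TN_tr.
    by by move: lt; rewrite !nnz_tr; lia.
  by apply: Pe; rewrite // adjacent_sym.
rewrite negb_exists => /forallP noU.
have off (i j : 'I_n) : i != j -> B i j = 0.
  rewrite -val_eqE /= neq_ltn => /orP[ij|ij].
    have := noU j; rewrite negb_exists => /forallP/(_ i).
    by rewrite ij mxE negbK => /eqP.
  have := noL i; rewrite negb_exists => /forallP/(_ j).
  by rewrite ij negbK => /eqP.
have -> : B = diag_mx (\row_i B i i).
  apply/matrixP => i j; rewrite !mxE; case: eqP => [->|/eqP/off->] //.
apply: Pd => i; rewrite mxE; case: nB => uB tB.
rewrite lt_neqAle TN_entry_ge0 // andbT eq_sym.
have [j] := row_nonzero i uB; have [->//|/off->] := eqVneq i j.
by rewrite eqxx.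
Qed.
End Factorization.

(** * Positive minors after multiplication by a generator *)

(** The positivity relation of the minors of [elem c p q] for neighbours [p], [q]
   and [c > 0]; since [J] is a k-subset, [q] cannot already belong to [K]. *)
Definition step (n k : nat) (p q : 'I_n) (K J : ksub n k) : Prop :=
  K = J \/ exists r, kth K r = p /\ kth J =1 upd (kth K) r q.

Section Generators.
Variables (R : realType) (n : nat).
Implicit Types (A B : 'M[R]_n) (c : R) (p q : 'I_n).

Lemma det_mul_elem A c p q k (f g : 'I_k -> 'I_n) r : injective g -> g r = q ->
  \det (mxsub f g (A *m elem c p q)) =
  \det (mxsub f g A) + c * \det (mxsub f (upd g r p) A).
Proof.
move=> gI gr; rewrite -det_tr trmx_mxsub trmx_mul elem_tr.
by rewrite (det_elem_mul _ _ _ _ gI gr) -!trmx_mxsub !det_tr.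
Qed.

Lemma det_mul_elem_id A c p q k (f g : 'I_k -> 'I_n) : (forall i, g i != q) ->
  \det (mxsub f g (A *m elem c p q)) = \det (mxsub f g A).
Proof.
move=> gq; rewrite -det_tr trmx_mxsub trmx_mul elem_tr.
by rewrite det_elem_mul_id // -trmx_mxsub det_tr.
Qed.

(** Adding a multiple of column [p] to column [q] changes a minor only if [q] is in
   [J] and [p] is not: if both are, the correction has a repeated column. *)
Lemma minor_mul_elem A c p q k (I J : ksub n k) : adjacent p q ->
  (minor (A *m elem c p q) I J = minor A I J /\ forall K, step p q K J -> K = J) \/
  exists K, [/\ minor (A *m elem c p q) I J = minor A I J + c * minor A I K,
    step p q K J & forall K', step p q K' J -> K' = J \/ K' = K].
Proof.
move=> pq; have npq := adjacent_neq pq.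
have Jinj := incr_inj (kth_incr J); have Jq K r : kth J =1 upd (kth K) r q -> kth J r = q.
  by move=> ->; rewrite /upd eqxx.
case: (pickP (fun r => kth J r == q)) => [r /eqP Jr|noq]; last first.
  left; split; first by rewrite /minor det_mul_elem_id // => i; rewrite noq.
  by move=> K [//|[r [_ /Jq/eqP]]]; rewrite noq.
case: (pickP (fun s => kth J s == p)) => [s /eqP Js|nop].
  left; split.
    rewrite /minor (det_mul_elem _ _ _ _ Jinj Jr) -det_tr trmx_mxsub -Js.
    rewrite -[X in _ + _ * X]det_tr trmx_mxsub det_upd_repeat ?mulr0 ?addr0.
      by rewrite -trmx_mxsub det_tr.
    by apply/eqP => sr; move: npq; rewrite -Js -Jr sr eqxx.
  move=> K [//|[r' [Kr' JK]]]; move: (JK s); rewrite Js /upd.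
  case: eqP => [_ pqE|/eqP sr' Ks]; first by rewrite pqE eqxx in npq.
  by move: sr'; rewrite -(inj_eq (incr_inj (kth_incr K))) -Ks Kr' eqxx.
have free i : kth J i != p by rewrite nop.
have [|K KE] := incr_kth (@incr_upd _ _ (kth J) r p (kth_incr J) _ free).
  by rewrite Jr adjacent_sym.
right; exists K; split.
- by rewrite /minor (det_mul_elem _ _ _ _ Jinj Jr) -(eq_mxsub _ _ (fun=> erefl) KE).
- right; exists r; rewrite KE /upd eqxx; split=> // i.
  by rewrite /upd KE /upd; case: eqP => // ->.
move=> K' [|[r' [Kr' JK]]]; [by left | right].
have rr : r' = r by apply: Jinj; rewrite Jr (Jq _ _ JK).
apply: kth_inj => i; rewrite KE /upd -rr; case: eqP => [->//|/eqP ir].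
by rewrite JK /upd (negPf ir).
Qed.

Lemma minor_mul_diag A (d : 'rV[R]_n) k (I J : ksub n k) :
  minor (A *m diag_mx d) I J = minor A I J * \prod_r d ord0 (kth J r).
Proof.
rewrite /minor.
have -> : mxsub (kth I) (kth J) (A *m diag_mx d) =
    mxsub (kth I) (kth J) A *m diag_mx (\row_r d ord0 (kth J r)).
  by apply/matrixP => i j; rewrite !mul_mx_diag !mxE.
by rewrite det_mulmx det_diag; congr (_ * _); apply: eq_bigr => i _; rewrite mxE.
Qed.

Lemma minor1 k (I J : ksub n k) : minor (1%:M : 'M[R]_n) I J = (I == J)%:R.
Proof.
rewrite /minor; case: eqVneq => [->|IJ].
  rewrite -[RHS](det1 R k); congr (\det _); apply/matrixP => i j; rewrite !mxE.
  by rewrite (inj_eq (incr_inj (kth_incr J))).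
have : ~~ (val I \subset val J).
  apply: contra IJ => sIJ; apply/eqP/val_inj/eqP.
  have /eqP cI := valP I; have /eqP cJ := valP J.
  by rewrite eqEcard sIJ /= cI cJ.
move=> /subsetPn[x /mem_kth[r rI] xJ].
rewrite (expand_det_row _ r) big1 // => j _.
rewrite !mxE rI; case: eqP => [xE|_]; last by rewrite mul0r.
by rewrite xE kth_mem in xJ.
Qed.

Lemma minor_ge0 A k (I J : ksub n k) : nonsingular_TN A -> 0 <= minor A I J.
Proof. by case=> _; apply. Qed.

Lemma nonsingular_TN1 : nonsingular_TN (1%:M : 'M[R]_n).
Proof. by split=> [|k I J]; rewrite ?unitmx1 // minor1 ler0n. Qed.

Lemma nonsingular_TN_mul_elem A c p q : nonsingular_TN A -> 0 < c ->
  adjacent p q -> nonsingular_TN (A *m elem c p q).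
Proof.
move=> nA c0 pq; split.
  by rewrite unitmx_mul elem_unit ?adjacent_neq // andbT; case: nA.
move=> k I J; case: (minor_mul_elem A c I J pq) => [[-> _]|[K [-> _ _]]].
  exact: minor_ge0.
by rewrite addr_ge0 ?mulr_ge0 ?minor_ge0 // ltW.
Qed.

Lemma nonsingular_TN_mul_diag A (d : 'rV[R]_n) : nonsingular_TN A ->
  (forall i, 0 < d ord0 i) -> nonsingular_TN (A *m diag_mx d).
Proof.
move=> nA d0; split.
  rewrite unitmx_mul nA.1 unitmxE det_diag unitfE gt_eqF //.
  by apply: prodr_gt0 => i _.
by move=> k I J; rewrite minor_mul_diag mulr_ge0 ?minor_ge0 ?prodr_ge0 // => i _; rewrite ltW.
Qed.

Lemma pos_mul_elem A c p q k (I J : ksub n k) : nonsingular_TN A -> 0 < c ->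
  adjacent p q ->
  0 < minor (A *m elem c p q) I J <-> exists K, 0 < minor A I K /\ step p q K J.
Proof.
move=> nA c0 pq; case: (minor_mul_elem A c I J pq) => [[-> h]|[K [-> sK h]]].
  split=> [IJ|[K [IK /h KJ]]]; last by rewrite -KJ.
  by exists J; split=> //; left.
split.
  have := minor_ge0 I J nA; rewrite le_eqVlt => /orP[/eqP<-|IJ _].
    by rewrite add0r pmulr_rgt0 // => IK; exists K.
  by exists J; split=> //; left.
move=> [K' [IK' /h[KE|KE]]]; rewrite KE in IK'.
  by rewrite ltr_pwDl // mulr_ge0 ?minor_ge0 // ltW.
by rewrite ltr_wpDl ?minor_ge0 // mulr_gt0.
Qed.

Lemma pos_elem c p q k (K J : ksub n k) : 0 < c -> adjacent p q ->
  0 < minor (elem c p q : 'M[R]_n) K J <-> step p q K J.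
Proof.
move=> c0 pq; rewrite -[elem c p q]mul1mx pos_mul_elem //; last exact: nonsingular_TN1.
split=> [[K' []]|sKJ]; first by rewrite minor1; case: eqP => [->|_]; rewrite ?ltxx.
by exists K; rewrite minor1 eqxx ltr01.
Qed.

Lemma pos_mul_diag A (d : 'rV[R]_n) k (I J : ksub n k) :
  (forall i, 0 < d ord0 i) -> (0 < minor (A *m diag_mx d) I J) = (0 < minor A I J).
Proof. by move=> d0; rewrite minor_mul_diag pmulr_lgt0 // prodr_gt0. Qed.
End Generators.

(** * Monotone interval relations on k-subsets *)

Section Intervals.
Variables (n k : nat).
Implicit Types (I J K L U : ksub n k) (p q : 'I_n) (b : bool).

(** The moves to the right and to the left are mirror images; the flag [b] selects
   the order or its converse so that one argument serves both. *)
Definition dle b (x y : nat) : bool := if b then (x <= y)%N else (y <= x)%N.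

Definition dpreceq b I J : bool := if b then preceq I J else preceq J I.

Lemma dpreceqP b I J : reflect (forall r, dle b (kth I r) (kth J r)) (dpreceq b I J).
Proof. by case: b; exact: preceqP. Qed.

Lemma dpreceq_refl b I : dpreceq b I I.
Proof. by case: b; exact: preceq_refl. Qed.

Lemma dpreceq_trans b J I K : dpreceq b I J -> dpreceq b J K -> dpreceq b I K.
Proof. by case: b => /= h h'; [exact: preceq_trans h h' | exact: preceq_trans h' h]. Qed.

(** The first two clauses are the monotonicity of the lower and of the upper
   endpoint, phrased through the relation itself: in this form they compose. *)
Definition monotone_interval b (S : ksub n k -> ksub n k -> Prop) : Prop :=
  [/\ forall I I' J', dpreceq b I I' -> S I' J' -> exists J, dpreceq b J J' /\ S I J,
      forall I I' J, dpreceq b I I' -> S I J -> exists J', dpreceq b J J' /\ S I' J'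
    & forall I, exists L U, [/\ dpreceq b L I, dpreceq b I U &
        forall J, S I J <-> dpreceq b L J /\ dpreceq b J U]].

Lemma monotone_intervalN b S : monotone_interval b S -> monotone_interval (~~ b) S.
Proof.
case=> dn up it; have e I J : dpreceq (~~ b) I J = dpreceq b J I by case: b {dn up it}.
split=> [I I' J'|I I' J|I].
- by rewrite e => h /(up _ _ _ h)[J [? ?]]; exists J; rewrite e.
- by rewrite e => h /(dn _ _ _ h)[J' [? ?]]; exists J'; rewrite e.
have [L [U [LI IU h]]] := it I; exists U, L; rewrite !e; split=> // J.
by rewrite !e h; split=> -[].
Qed.

Lemma monotone_interval_ext b (S T : ksub n k -> ksub n k -> Prop) :
  (forall I J, S I J <-> T I J) -> monotone_interval b S -> monotone_interval b T.
Proof.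
move=> e [dn up it]; split=> [I I' J' h|I I' J h|I].
- by move/e => /(dn _ _ _ h)[J [? /e ?]]; exists J.
- by move/e => /(up _ _ _ h)[J' [? /e ?]]; exists J'.
by have [L [U [? ? h]]] := it I; exists L, U; split=> // J; rewrite -e.
Qed.

Definition covers b p q : Prop := if b then q = p.+1 :> nat else p = q.+1 :> nat.

Lemma covers_adjacent b p q : covers b p q -> adjacent p q.
Proof. by rewrite /adjacent; case: b => /= ->; rewrite eqxx ?orbT. Qed.

Lemma step_dpreceq b p q K J : covers b p q -> step p q K J -> dpreceq b K J.
Proof.
move=> pq [->|[r [Kr JE]]]; first exact: dpreceq_refl.
apply/dpreceqP => s; rewrite JE /upd; case: eqP => [->|_]; last by case: b {pq} => /=.
by rewrite Kr; case: b pq => /= ->; lia.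
Qed.

(** If [q] were in [M], it would sit next to [p] in the direction of the move. The
   element of [K] at that position lies strictly beyond [p] without passing [q],
   so it is [q], but [q] is free in [K]. *)
Lemma step_free b p q K J M r : covers b p q ->
  kth K r = p -> kth J =1 upd (kth K) r q ->
  dpreceq b K M -> kth M r = p -> forall s, kth M s != q.
Proof.
move=> pq Kr JE /dpreceqP KM Mr s; apply/eqP => Ms.
have sr : s != r by apply/eqP => sr; move: pq; rewrite -Ms -Mr sr; case: b {KM} => /=; lia.
have Ksq : kth K s != q.
  apply/eqP => Ks; move: sr; rewrite -(inj_eq (incr_inj (kth_incr J))).
  by rewrite !JE /upd eqxx; case: (s == r); rewrite ?Ks eqxx.
move: (KM s) Ksq pq; rewrite -val_eqE /= Ms.
have := incr_ltn r s (kth_incr K); have := incr_ltn s r (kth_incr K).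
have := incr_ltn r s (kth_incr M); have := incr_ltn s r (kth_incr M).
by rewrite Kr Mr Ms; case: b {KM} => /=; lia.
Qed.

Lemma step_up b p q K K' J : covers b p q -> dpreceq b K K' -> step p q K J ->
  exists J', dpreceq b J J' /\ step p q K' J'.
Proof.
move=> pq KK' [<-|[r [Kr JE]]]; first by exists K'; split=> //; left.
have K'K := KK'; move/dpreceqP: KK' => KK'.
have [Kr'|Kr'] := eqVneq (kth K' r) p.
  have free := step_free pq Kr JE K'K Kr'.
  have [|J' J'E] := incr_kth (@incr_upd _ _ _ r q (kth_incr K') _ free).
    by rewrite Kr'; exact: covers_adjacent pq.
  exists J'; split; last by right; exists r.
  apply/dpreceqP => s; rewrite JE J'E /upd; case: eqP => // _.
  by case: (b) => /=.
exists K'; split; last by left.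
apply/dpreceqP => s; rewrite JE /upd; case: eqP => // ->.
have := KK' r; move: Kr' pq; rewrite Kr -val_eqE /=.
by case: (b) => /=; lia.
Qed.

(** [U'] is [U] after the move if the move is possible in [U], and [U] otherwise.
   A [J] below [U'] but not below [U] must agree with [U'] at the moved position,
   and undoing the move there leads to the required [K]. *)
Lemma step_interval b p q U : covers b p q ->
  exists U', [/\ dpreceq b U U',
    forall K J, dpreceq b K U -> step p q K J -> dpreceq b J U' &
    forall L J, dpreceq b L U -> dpreceq b L J -> dpreceq b J U' ->
      exists K, [/\ dpreceq b L K, dpreceq b K U & step p q K J]].
Proof.
move=> pq; have npq := adjacent_neq (covers_adjacent pq).
case: (boolP [exists r, (kth U r == p) && [forall s, kth U s != q]]) => [|no].
  move=> /existsP[r /andP[/eqP Ur /forallP Uq]].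
  have [|U' U'E] := incr_kth (@incr_upd _ _ _ r q (kth_incr U) _ Uq).
    by rewrite Ur; exact: covers_adjacent pq.
  have UU' : dpreceq b U U' by apply: (step_dpreceq pq); right; exists r.
  exists U'; split=> //.
    move=> K J KU [<-|[r' [Kr' JE]]]; first exact: dpreceq_trans KU UU'.
    move/dpreceqP: (KU) => {}KU; move/dpreceqP: UU' => UU'.
    apply/dpreceqP => s; rewrite JE /upd; case: eqP => [->|_].
      have [->|rr] := eqVneq r' r; first by rewrite U'E /upd eqxx; case: (b) => /=.
      rewrite U'E /upd (negPf rr); move: rr.
      rewrite -(inj_eq (incr_inj (kth_incr U))) Ur -val_eqE /=.
      by have := KU r'; rewrite Kr'; move: pq; case: (b) => /=; lia.
    have := KU s; have := UU' s; case: (b) => /=; lia.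
  move=> L J LU LJ JU'; have JUs s : s != r -> dle b (kth J s) (kth U s).
    by move=> sr; have /dpreceqP/(_ s) := JU'; rewrite U'E /upd (negPf sr).
  have [Jr|Jr] := eqVneq (kth J r) q; last first.
    exists J; split=> //; last by left.
    apply/dpreceqP => s; have [->|/JUs//] := eqVneq s r.
    have /dpreceqP/(_ r) := JU'; rewrite U'E /upd eqxx Ur.
    by move: Jr pq; rewrite -val_eqE /=; case: (b) => /=; lia.
  (* In the direction of the move, [p] in [J] would stand before position [r], where
     [U], and hence [J], has not reached [p] yet. *)
  have Jp t : kth J t != p.
    apply/eqP => Jt; have tr : t != r.
      by apply/eqP => tr; move: npq; rewrite -Jt -Jr tr eqxx.
    have := JUs t tr; move: pq; rewrite Jt.
    have := incr_ltn r t (kth_incr J); have := incr_ltn t r (kth_incr J).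
    have := incr_ltn r t (kth_incr U); have := incr_ltn t r (kth_incr U).
    by rewrite Ur Jr Jt; case: (b) => /=; lia.
  have [|K KE] := incr_kth (@incr_upd _ _ _ r p (kth_incr J) _ Jp).
    by rewrite Jr adjacent_sym; exact: covers_adjacent pq.
  exists K; split.
  - apply/dpreceqP => s; rewrite KE /upd; case: eqP => [->|_].
      by rewrite -Ur; move/dpreceqP: LU; apply.
    by move/dpreceqP: LJ; apply.
  - apply/dpreceqP => s; rewrite KE /upd; case: eqP => [->|/eqP/JUs//].
    by rewrite Ur; case: (b) => /=.
  right; exists r; rewrite KE /upd eqxx; split=> // s.
  by rewrite /upd KE /upd; case: eqP => // ->.
exists U; split=> [|K J KU [<-//|[r [Kr JE]]]|L J LU LJ JU]; first exact: dpreceq_refl.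
  apply/dpreceqP => s; move/dpreceqP: (KU) => KUs.
  rewrite JE /upd; case: eqP => // ->.
  have Ur : kth U r != p.
    apply: contra no => /eqP Ur; apply/existsP; exists r; rewrite Ur eqxx.
    by apply/forallP; exact: step_free pq Kr JE KU Ur.
  have := KUs r; move: Ur pq; rewrite Kr -val_eqE /=.
  by case: (b) => /=; lia.
by exists J; split=> //; left.
Qed.

Lemma monotone_interval_step b p q S : covers b p q -> monotone_interval b S ->
  monotone_interval b (fun I J => exists K, S I K /\ step p q K J).
Proof.
move=> pq [dn up it]; split=> [I I' J' h [K [/(dn _ _ _ h)[J [JK IJ]] KJ']]|I I' J h [K [IK KJ]]|I].
- exists J; split; first exact: dpreceq_trans JK (step_dpreceq pq KJ').
  by exists J; split=> //; left.
- have [K' [KK' I'K']] := up _ _ _ h IK.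
  by have [J' [JJ' ?]] := step_up pq KK' KJ; exists J'; split=> //; exists K'.
have [L [U [LI IU h]]] := it I; have [U' [UU' fwd bwd]] := step_interval U pq.
exists L, U'; split=> //; first exact: dpreceq_trans UU'.
move=> J; split=> [[K [/h[LK KU] KJ]]|[LJ JU']].
  by split; [exact: dpreceq_trans (step_dpreceq pq KJ) | exact: fwd KU KJ].
have [K [LK KU KJ]] := bwd _ _ (dpreceq_trans LI IU) LJ JU'.
by exists K; split=> //; apply/h.
Qed.

Lemma monotone_interval_adjacent p q S : adjacent p q -> monotone_interval true S ->
  monotone_interval true (fun I J => exists K, S I K /\ step p q K J).
Proof.
case/orP=> /eqP pq hS; first exact: monotone_interval_step.
exact/(@monotone_intervalN false)/monotone_interval_step/(@monotone_intervalN true).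
Qed.

Lemma monotone_interval_eq : monotone_interval true (fun I J => I = J).
Proof.
split=> [I I' _ h <-|I I' _ h <-|I]; first by exists I.
  by exists I'.
exists I, I; split=> [||J]; try exact: preceq_refl.
by split=> [->|[h h']]; [split; exact: preceq_refl | exact: preceq_anti].
Qed.
End Intervals.

(** * Endpoint maps of nonsingular totally nonnegative matrices *)

Section Main.
Variables (R : realType) (n : nat).
Implicit Types (A B : 'M[R]_n).

(** Quantifying over the left factor [A] makes this property of [B] stable under
   products by associativity alone. *)
Definition acts_by_intervals B : Prop :=
  forall A, nonsingular_TN A ->
  [/\ nonsingular_TN (A *m B),
      forall k (I J : ksub n k), 0 < minor (A *m B) I J <->
        exists K, 0 < minor A I K /\ 0 < minor B K J
    & forall k, monotone_interval true (fun I J : ksub n k => 0 < minor A I J) ->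
        monotone_interval true (fun I J : ksub n k => 0 < minor (A *m B) I J)].

Lemma nonsingular_TN_acts B : nonsingular_TN B -> acts_by_intervals B.
Proof.
move: B; apply: nonsingular_TN_ind => [d d0|c p q c0 pq|B1 B2 h1 h2] A nA.
- split; first exact: nonsingular_TN_mul_diag.
    move=> k I J; rewrite pos_mul_diag //; rewrite -[diag_mx d]mul1mx; split.
      by exists J; rewrite pos_mul_diag // minor1 eqxx ltr01.
    move=> [K []]; rewrite pos_mul_diag // minor1; case: eqP => [->//|].
    by rewrite ltxx.
  by move=> k; apply: monotone_interval_ext => I J; rewrite pos_mul_diag.
- split; first exact: nonsingular_TN_mul_elem.
    move=> k I J; rewrite pos_mul_elem //.
    by split=> -[K [IK /(pos_elem _ _ c0 pq) KJ]]; exists K.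
  move=> k /(monotone_interval_adjacent pq).
  by apply: monotone_interval_ext => I J; rewrite pos_mul_elem.
have [nA1 c1 i1] := h1 A nA; have [nA2 c2 i2] := h2 _ nA1.
have nB1 : nonsingular_TN B1.
  by have [+ _ _] := h1 _ (nonsingular_TN1 R n); rewrite mul1mx.
have [_ c12 _] := h2 _ nB1; rewrite mulmxA; split=> // k; last by move/i1/i2.
move=> I J; rewrite c2; split=> [[K [/c1[K1 [? ?]] ?]]|[K [IK /c12[K1 [? ?]]]]].
  by exists K1; split=> //; apply/c12; exists K.
by exists K1; split=> //; apply/c1; exists K.
Qed.

Lemma nonsingular_TN_mul A B :
  nonsingular_TN A -> nonsingular_TN B -> nonsingular_TN (A *m B).
Proof. by move=> nA /nonsingular_TN_acts/(_ A nA)[]. Qed.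

Lemma pos_mul A B k (I J : ksub n k) : nonsingular_TN A -> nonsingular_TN B ->
  0 < minor (A *m B) I J <-> exists K, 0 < minor A I K /\ 0 < minor B K J.
Proof. by move=> nA /nonsingular_TN_acts/(_ A nA)[_ h _]; exact: h. Qed.

Lemma nonsingular_TN_interval B k : nonsingular_TN B ->
  monotone_interval true (fun I J : ksub n k => 0 < minor B I J).
Proof.
move=> /nonsingular_TN_acts/(_ _ (nonsingular_TN1 R n))[_ _ /(_ k)].
rewrite mul1mx; apply; apply: monotone_interval_ext (@monotone_interval_eq n k).
by move=> I J; rewrite minor1; case: eqP => [->|]; rewrite ?ltr01 ?ltxx.
Qed.

Definition lambda k B (I : ksub n k) : ksub n k :=
  odflt I [pick L | (0 < minor B I L) &&
                    [forall J, (0 < minor B I J) ==> preceq L J]].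

Definition rho k B (I : ksub n k) : ksub n k :=
  odflt I [pick U | (0 < minor B I U) &&
                    [forall J, (0 < minor B I J) ==> preceq J U]].

Lemma lambda_rhoP k B (I : ksub n k) : nonsingular_TN B ->
  [/\ preceq (lambda B I) I, preceq I (rho B I) &
   forall J, 0 < minor B I J <-> preceq (lambda B I) J /\ preceq J (rho B I)].
Proof.
move=> nB; have [_ _ /(_ I)[L [U [/= LI IU h]]]] := nonsingular_TN_interval k nB.
have LU := preceq_trans LI IU.
have pL : 0 < minor B I L by apply/h; rewrite preceq_refl.
have pU : 0 < minor B I U by apply/h; rewrite preceq_refl.
have -> : lambda B I = L.
  rewrite /lambda; case: pickP => [L' /andP[pL' /forallP hL']|/(_ L)] /=.
    apply: preceq_anti; first by have := hL' L; rewrite pL.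
    by case/h: pL'.
  rewrite pL /= => /negbT; rewrite negb_forall => /existsP[J].
  by rewrite negb_imply => /andP[/h[->]].
have -> : rho B I = U.
  rewrite /rho; case: pickP => [U' /andP[pU' /forallP hU']|/(_ U)] /=.
    apply: preceq_anti; last by have := hU' U; rewrite pU.
    by case/h: pU'.
  rewrite pU /= => /negbT; rewrite negb_forall => /existsP[J].
  by rewrite negb_imply => /andP[/h[_ ->]].
by [].
Qed.

Lemma pos_lambda k B (I : ksub n k) : nonsingular_TN B -> 0 < minor B I (lambda B I).
Proof.
move=> nB; have [h1 h2 h] := lambda_rhoP I nB.
by apply/h; split; [exact: preceq_refl | exact: preceq_trans h1 h2].
Qed.

Lemma pos_rho k B (I : ksub n k) : nonsingular_TN B -> 0 < minor B I (rho B I).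
Proof.
move=> nB; have [h1 h2 h] := lambda_rhoP I nB.
by apply/h; split; [exact: preceq_trans h1 h2 | exact: preceq_refl].
Qed.

Lemma lambda_le k B (I J : ksub n k) :
  nonsingular_TN B -> 0 < minor B I J -> preceq (lambda B I) J.
Proof. by move=> nB; have [_ _ h] := lambda_rhoP I nB => /h[]. Qed.

Lemma rho_ge k B (I J : ksub n k) :
  nonsingular_TN B -> 0 < minor B I J -> preceq J (rho B I).
Proof. by move=> nB; have [_ _ h] := lambda_rhoP I nB => /h[]. Qed.

Lemma lambda_order_preserving k B :
  nonsingular_TN B -> order_preserving (@lambda k B).
Proof.
move=> nB I I' II'; have [dn _ _] := nonsingular_TN_interval k nB.
have [J [JL IJ]] := dn _ _ _ II' (pos_lambda I' nB).
exact: preceq_trans (lambda_le nB IJ) JL.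
Qed.

Lemma rho_order_preserving k B : nonsingular_TN B -> order_preserving (@rho k B).
Proof.
move=> nB I I' II'; have [_ up _] := nonsingular_TN_interval k nB.
have [J [JU IJ]] := up _ _ _ II' (pos_rho I nB).
exact: preceq_trans JU (rho_ge nB IJ).
Qed.

(** The endpoint of the composite is attained by following the two endpoints; any
   other path ends beyond it because [lambda B] preserves the order. *)
Lemma lambda_mul k A B : nonsingular_TN A -> nonsingular_TN B ->
  @lambda k (A *m B) =1 lambda B \o lambda A.
Proof.
move=> nA nB I; have nAB := nonsingular_TN_mul nA nB; apply: preceq_anti.
  apply: lambda_le => //; apply/pos_mul => //; exists (lambda A I).
  by split; exact: pos_lambda.
have /pos_mul[//|//|K [IK KJ]] := pos_lambda I nAB.
apply: preceq_trans (lambda_le nB KJ); apply: lambda_order_preserving => //.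
exact: lambda_le.
Qed.

Lemma rho_mul k A B : nonsingular_TN A -> nonsingular_TN B ->
  @rho k (A *m B) =1 rho B \o rho A.
Proof.
move=> nA nB I; have nAB := nonsingular_TN_mul nA nB; apply: preceq_anti; last first.
  apply: rho_ge => //; apply/pos_mul => //; exists (rho A I).
  by split; exact: pos_rho.
have /pos_mul[//|//|K [IK KJ]] := pos_rho I nAB.
apply: preceq_trans (rho_ge nB KJ) _; apply: rho_order_preserving => //.
exact: rho_ge.
Qed.

Lemma lambda_rho_pow k B m : nonsingular_TN B ->
  [/\ nonsingular_TN (B ^+ m.+1), @lambda k (B ^+ m.+1) =1 iter m.+1 (lambda B)
    & @rho k (B ^+ m.+1) =1 iter m.+1 (rho B)].
Proof.
move=> nB; elim: m => [|m [nBm lE rE]]; first by split.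
rewrite exprSr; split=> [|I|I]; first exact: nonsingular_TN_mul.
  by rewrite lambda_mul //= lE.
by rewrite rho_mul //= rE.
Qed.
End Main.

Theorem theorem3p3 (R : realType) (n k : nat) (hn : (2 <= n)%N)
    (hk1 : (1 <= k)%N) (hkn : (k <= n)%N) :
  exists lambda rho : 'M[R]_n -> ksub n k -> ksub n k,
    [/\ forall B : 'M[R]_n, nonsingular_TN B ->
          [/\ order_preserving (lambda B) /\ order_preserving (rho B),
              forall I, preceq (lambda B I) I /\ preceq I (rho B I),
              forall I J,
                0 < minor B I J <->
                preceq (lambda B I) J /\ preceq J (rho B I)
            & forall I,
                is_smallest (fun J => 0 < compound B I J) (lambda B I) /\
                is_largest (fun J => 0 < compound B I J) (rho B I)],
        forall A B : 'M[R]_n, nonsingular_TN A -> nonsingular_TN B ->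
          lambda (A *m B) =1 lambda B \o lambda A /\
          rho (A *m B) =1 rho B \o rho A
      & forall B : 'M[R]_n, nonsingular_TN B ->
          forall m : nat, (1 <= m)%N -> forall I J,
            0 < minor (B ^+ m) I J <->
            preceq (iter m (lambda B) I) J /\ preceq J (iter m (rho B) I)].
Proof.
exists (@lambda R n k), (@rho R n k); split.
- move=> B nB; split.
  + by split; [exact: lambda_order_preserving | exact: rho_order_preserving].
  + by move=> I; have [? ? _] := lambda_rhoP I nB.
  + by move=> I J; have [_ _ h] := lambda_rhoP I nB; exact: h.
  move=> I; split; split.
  + exact: pos_lambda.
  + by move=> J; exact: lambda_le.
  + exact: pos_rho.
  + by move=> J; exact: rho_ge.
- by move=> A B nA nB; split; [exact: lambda_mul | exact: rho_mul].
move=> B nB [//|m] _ I J; have [nBm <- <-] := lambda_rho_pow k m nB.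
by have [_ _ h] := lambda_rhoP I nBm; exact: h.
Qed.
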